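(* Let $n_1,n_2,n_3\ge 1$ be integers, $N=n_1+n_2+n_3$, and let $k$ be an integer with $1\le k\le N/2$. Put $$m_L:=\max\{0,\,k-n_3\},\qquad m_U:=\min\{n_1,\,n_2,\,k,\,n_1+n_2-k\},$$ and assume $m_L\le m_U$. Let $g_3\in\mathcal S_N$ be the $3$-cycle $(1,\;n_1+1,\;n_1+n_2+1)$. Define $$\zeta(k,m):=m^2(3k-2m)+m(n_3^2-k^2)-(n_3-k+m)\bigl(m(n_1+n_2+n_3)-n_1n_2\bigr),$$ $$\xi(k,m):=(m+1)(n_3-k+m+1)(k-m)\,\frac{n_1n_2-m^2}{n_1+n_2-2m}\quad(m\neq k),\qquad \xi(k,k):=0.$$ Then $$\Phi^{[N-k,k]}(g_3)=\frac{1}{n_1n_2n_3}\left\{\sum_{m=m_L}^{m_U}\zeta(k,m)-\xi(k,m_U)\right\}.$$ Equivalently, with $\mu:=m_U-m_L$, $\nu:=m_L$, $\delta:=k-m_U$, $$\Phi^{[N-k,k]}(g_3)=\frac{\mu+1}{n_1n_2n_3}\Bigl\{\tfrac16N\mu(\mu-1)+\tfrac12N(\mu\nu+\mu\delta+2\nu\delta)-\tfrac12(\mu+2\nu)(n_1n_2+n_1n_3+n_2n_3)+n_1n_2n_3$$ $$\qquad+\tfrac12\mu\nu(\nu-1)+(\nu-\delta)(n_1n_2+\nu\delta)-\tfrac12\mu\delta(\delta-1)-\tfrac{1}{\mu+1}\xi(k,m_U)\Bigr\}.$$ In particular, if $k\le n_3$ (so that $m_L=0$ and $\mu=m_U$),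 then $$\Phi^{[N-k,k]}(g_3)=\frac{\mu+1}{n_1n_2n_3}\Bigl\{n_1n_2n_3-\tfrac12\mu(n_1n_2+n_1n_3+n_2n_3)+\tfrac16N\mu(\mu-1)+\tfrac12(k-\mu)\bigl(\mu(N-k+\mu+1)-2n_1n_2\bigr)-\tfrac1{\mu+1}\xi(k,\mu)\Bigr\}.$$
   Context: $\mathcal S_N$ is the symmetric group on $\{1,\dots,N\}$. Let $I_1=\{1,\dots,n_1\}$, $I_2=\{n_1+1,\dots,n_1+n_2\}$, $I_3=\{n_1+n_2+1,\dots,N\}$, and let $G_{\mathbf n}\cong\mathcal S_{n_1}\times\mathcal S_{n_2}\times\mathcal S_{n_3}$ be the Young subgroup of $\mathcal S_N$ leaving each of $I_1,I_2,I_3$ setwise invariant. For a partition $\tau$ of $N$ let $\chi^\tau$ be the character of the irreducible representation of $\mathcal S_N$ of isotype $\tau$. The spherical function is $$\Phi^\tau(g):=\frac{1}{\#G_{\mathbf n}}\sum_{h\in G_{\mathbf n}}\chi^\tau(gh),\qquad g\in\mathcal S_N,\qquad \#G_{\mathbf n}=n_1!\,n_2!\,n_3!.$$ $[N-k,k]$ denotes the two-row partition of $N$ with parts $N-k$ and $k$ (an irreducible representation of degree $\binom Nk-\binom N{k-1}$). Under the stated assumptions, $n_1+n_2-2m_U=0$ can only happen when $m_U=k$, in which case $\xi(k,m_U)=0$ by the convention $\xi(k,k)=0$. *)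

(* Defs.v *)
From mathcomp Require Import all_boot all_order all_algebra.
From mathcomp Require Import all_fingroup all_solvable all_field all_character.

Set Implicit Arguments.
Unset Strict Implicit.
Unset Printing Implicit Defensive.

Import Order.TTheory GRing.Theory Num.Theory.
Local Open Scope ring_scope.

(* Permutations act on {0, .., N-1} = 'I_N (the paper's {1, .., N} shifted by
   one), and (s * t)%g is "s first, then t". *)

Section Specht.

Variables (N : nat) (tau : seq nat).

(* For tau a partition of N, the tableau of shape tau whose entries 0, .., N-1
   are written row after row has i in row (reshape_index tau i) and column
   (reshape_offset tau i). *)
Definition row_stabiliser : {set 'S_N} :=
  [set s : 'S_N | [forall i : 'I_N,
     reshape_index tau (s i) == reshape_index tau i]].

Definition column_stabiliser : {set 'S_N} :=
  [set s : 'S_N | [forall i : 'I_N,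
     reshape_offset tau (s i) == reshape_offset tau i]].

(* The Young symmetrizer (\sum_p p) (\sum_q sgn(q) q) of that tableau, in the
   coordinates of the regular representation. *)
Definition young_symmetrizer : 'rV[algC]_#|[set: 'S_N]| :=
  \sum_(p in row_stabiliser) \sum_(q in column_stabiliser)
    (-1) ^+ odd_perm q *: delta_mx 0 (gring_index [set: 'S_N]%G (p * q)%g).

(* The right ideal generated by the Young symmetrizer. Since the ideal
   generated by \sum_p p is the permutation module on tabloids, this is the
   module spanned by the polytabloids, i.e. the Specht module of shape tau. *)
Definition specht_repr :=
  submod_repr (cyclic_mx_module (regular_repr algC [set: 'S_N]%G)
                                young_symmetrizer).

Definition irr_char : 'CF([set: 'S_N]) := cfRepr specht_repr.

End Specht.

Section Spherical.

Variables n1 n2 n3 : nat.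

Let N := (n1 + n2 + n3)%N.

Definition I1 : {set 'I_N} := [set i : 'I_N | (i < n1)%N].
Definition I2 : {set 'I_N} := [set i : 'I_N | (n1 <= i < n1 + n2)%N].
Definition I3 : {set 'I_N} := [set i : 'I_N | (n1 + n2 <= i)%N].

Definition young_subgroup : {set 'S_N} :=
  [set s : 'S_N | [&& s @: I1 == I1, s @: I2 == I2 & s @: I3 == I3]].

(* (h * g)%g is the composite of functions g \o h. *)
Definition spherical (tau : seq nat) (g : 'S_N) : algC :=
  (#|young_subgroup|%:R)^-1
    * \sum_(h in young_subgroup) irr_char N tau (h * g)%g.

Hypotheses (n1_gt0 : (0 < n1)%N) (n2_gt0 : (0 < n2)%N) (n3_gt0 : (0 < n3)%N).

Fact first_I1_subproof : (0 < N)%N.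
Proof. by rewrite /N !addn_gt0 n1_gt0. Qed.

Fact first_I2_subproof : (n1 < N)%N.
Proof. by rewrite /N -addnA -[X in (X < _)%N]addn0 ltn_add2l addn_gt0 n2_gt0. Qed.

Fact first_I3_subproof : (n1 + n2 < N)%N.
Proof. by rewrite /N -[X in (X < _)%N]addn0 ltn_add2l. Qed.

Definition first_I1 : 'I_N := Ordinal first_I1_subproof.
Definition first_I2 : 'I_N := Ordinal first_I2_subproof.
Definition first_I3 : 'I_N := Ordinal first_I3_subproof.

Definition g3 : 'S_N :=
  (tperm first_I1 first_I2 * tperm first_I1 first_I3)%g.

Lemma g3_cycle :
  [/\ g3 first_I1 = first_I2, g3 first_I2 = first_I3, g3 first_I3 = first_I1
    & forall i, i \notin [:: first_I1; first_I2; first_I3] -> g3 i = i].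
Proof.
have n12 : first_I1 != first_I2 by rewrite -val_eqE /= neq_ltn n1_gt0.
have n13 : first_I1 != first_I3.
  by rewrite -val_eqE /= neq_ltn addn_gt0 n1_gt0.
have n23 : first_I2 != first_I3.
  by rewrite -val_eqE /= neq_ltn -[X in (X < _)%N]addn0 ltn_add2l n2_gt0.
split=> [|||i].
- by rewrite permM tpermL tpermD // eq_sym.
- by rewrite permM tpermR tpermL.
- by rewrite permM (tpermD n13 n23) tpermR.
rewrite !inE !negb_or => /and3P[i1 i2 i3].
by rewrite permM !tpermD // eq_sym.
Qed.

End Spherical.

Definition zeta (n1 n2 n3 k m : algC) : algC :=
  m ^+ 2 * (3 * k - 2 * m) + m * (n3 ^+ 2 - k ^+ 2)
  - (n3 - k + m) * (m * (n1 + n2 + n3) - n1 * n2).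

Definition xi (n1 n2 n3 k m : algC) : algC :=
  if m == k then 0
  else (m + 1) * (n3 - k + m + 1) * (k - m)
       * ((n1 * n2 - m ^+ 2) / (n1 + n2 - 2 * m)).

(* These bounds are taken in int: n1 + n2 - k can be negative, and then
   mL <= mU fails. *)
Definition mL (n3 k : nat) : int := Num.max 0 (k%:Z - n3%:Z).

Definition mU (n1 n2 k : nat) : int :=
  Num.min n1%:Z (Num.min n2%:Z (Num.min k%:Z (n1%:Z + n2%:Z - k%:Z))).

(* Main.v *)
Require Import Defs.
From mathcomp Require Import all_boot all_order all_algebra.
From mathcomp Require Import all_fingroup all_solvable all_field all_character.
From mathcomp Require Import ring zify.

Set Implicit Arguments.
Unset Strict Implicit.
Unset Printing Implicit Defensive.

Import Order.TTheory GRing.Theory Num.Theory.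
Local Open Scope ring_scope.

(** Why the formula holds.

    Write pi_l for the permutation character of S_N on subsets of size l
    ([subset_char]).  The irreducible character of shape (N-k, k) is
    pi_k - pi_(k-1) ([irr_char_two_rows]), so the spherical function is the
    difference of the averages over the Young subgroup of pi_k (h g) and of
    pi_(k-1) (h g).

    For the character identity, counting orbits of the stabiliser of a subset
    gives <pi_j, pi_l> = j + 1 when j <= l and j + l <= N, hence
    pi_k - pi_(k-1) has norm one and is, up to sign, irreducible.  The Specht
    module, the right ideal generated by the Young symmetrizer, lies inside
    the right ideal generated by the sum of the row stabiliser, whose character
    is pi_k ([specht_sub_subset_char]); and its character is orthogonal to
    pi_(k-1), because averaging a polytabloid over the stabiliser of k-1 points
    gives zero: one of the k columns of length two has both ends inside or both
    ends outside these points, and exchanging the two ends changes the sign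
    ([young_symmetrizer_average]).  These two facts force the Specht character
    to be pi_k - pi_(k-1) ([character_of_difference]).

    The average of pi_l (h g_3) is the sum over the subsets A of size l of the
    probability that a random h carries A to its preimage under g_3.  Orbits of
    the Young subgroup are indexed by the numbers a_j of points of A in the
    block I_j, and g_3 keeps these numbers exactly when A contains all three of
    the moved points or none of them.  Within an orbit this has probability
    (a_1 a_2 a_3 + (n_1-a_1)(n_2-a_2)(n_3-a_3)) / (n_1 n_2 n_3)
    ([young_average_subset_char]).

    What remains is arithmetic: the difference of two such sums over
    a_1 + a_2 + a_3 = k and a_1 + a_2 + a_3 = k-1.  Grouping by a_1 + a_2 = s
    turns it into a sum of p(s) - q(s), with p(s) and q(s) the sums of a_1 a_2
    and (n_1-a_1)(n_2-a_2) on the diagonal s, plus boundary terms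
    ([young_sum_diff]).  For n_1 <= n_2 these are polynomials in s for s <= n_1
    and for n_1 <= s <= n_2, while p(s) - q(s) is antisymmetric under
    s -> n_1 + n_2 - s; the three possible values k, n_1, n_1 + n_2 - k of m_U
    are the three positions of k relative to these ranges
    ([young_sum_diff_le]). *)

(** * Averages over orbits of a group action *)

Section OrbitAverage.

Variables (aT : finGroupType) (rT : finType) (to : {action aT &-> rT}).
Variable H : {group aT}.

Lemma sum_act (V : nmodType) (f : rT -> V) (x : rT) :
  \sum_(h in H) f (to x h) =
  \sum_(y in orbit to H x) f y *+ #|('C_H[x | to])%g|.
Proof.
rewrite (partition_big (to x) (mem (orbit to H x))) /=; last first.
  by move=> h Hh; apply: mem_orbit.
apply: eq_bigr => _ /orbitP[a Ha <-].
rewrite (eq_bigr (fun=> f (to x a))) => [|h /andP[_ /eqP->] //].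
rewrite sumr_const; congr (_ *+ _).
rewrite -(card_rcoset _ a) -(amove_act to x (subsetT H) Ha).
by apply: eq_card => h; rewrite !inE.
Qed.

(** A Burnside count twisted by g: for a fixed x, the h that carry x to its
    preimage under g exist only if that preimage is in the orbit of x, and then
    they form a coset of the stabiliser of x. *)
Lemma twisted_burnside (S : {set rT}) (g : aT) :
  #|H|%:R^-1 * \sum_(h in H) #|[set x in S | to x (h * g)%g == x]|%:R =
  \sum_(x in S) (to x g^-1%g \in orbit to H x)%:R / #|orbit to H x|%:R :> algC.
Proof.
under eq_bigr => h _.
  rewrite -sum1_card natr_sum big_mkcond /=.
  under eq_bigr => x _ do rewrite inE.
  over.
rewrite exchange_big mulr_sumr [RHS]big_mkcond /=; apply: eq_bigr => x _.
have [Sx | _] := boolP (x \in S); last by rewrite /= big1 ?mulr0.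
under eq_bigr => h _ do rewrite /= actM (canF_eq (actK to g)) -mulrb.
rewrite (sum_act (fun y => (y == _)%:R)).
rewrite -(card_orbit_in_stab to x (subsetT H)) natrM.
have nz1: #|orbit to H x|%:R != 0 :> algC.
  by rewrite pnatr_eq0 -lt0n; apply/card_gt0P; exists x; apply: orbit_refl.
have nz2: #|('C_H[x | to])%g|%:R != 0 :> algC by rewrite pnatr_eq0 -lt0n cardG_gt0.
have [Ox | nOx] := boolP (to x g^-1%g \in orbit to H x); last first.
  rewrite big1 ?mulr0 ?mul0r // => y Oy.
  by case: eqP Oy nOx => [-> -> | ] //; rewrite mul0rn.
rewrite (bigD1 _ Ox) /= eqxx big1 ?addr0 => [|y /andP[_ /negbTE->]].
  by rewrite -mulr_natl mulr1 mul1r invfM mulfVK.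
by rewrite mul0rn.
Qed.

End OrbitAverage.

(** * Young subgroups and their orbits on subsets *)

Section ColourGroup.

Variables (N : nat).
Implicit Types (A B : {set 'I_N}) (s : 'S_N).

(** Two colourings with the same number of points of each colour have value
    lists that are permutations of each other. *)
Lemma perm_of_fibers (C : eqType) (F F' : 'I_N -> C) :
    (forall c, #|[set i | F i == c]| = #|[set i | F' i == c]|) ->
  exists s : 'S_N, forall i, F' (s i) = F i.
Proof.
move=> FF'; pose t (E : 'I_N -> C) := [tuple E i | i < N].
have cnt (E : 'I_N -> C) c : count_mem c (t E) = #|[set i | E i == c]|.
  rewrite /t /= count_map -size_filter cardE; congr size.
  by rewrite enumT; apply: eq_filter => i; rewrite !inE.
have /tuple_permP[s tFs]: perm_eq (t F) (t F').
  by apply/allP => c _; rewrite /= !cnt FF'.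
exists s => i.
have/(congr1 (fun u => tnth u i)): t F = [tuple tnth (t F') (s i) | i < N].
  exact: val_inj.
by rewrite !tnth_mktuple.
Qed.

Variables (C : eqType) (c : 'I_N -> C).

(** A Young subgroup, given by the colouring whose fibers are its blocks; this
    covers row and column stabilisers, stabilisers of subsets and the Young
    subgroup of the theorem. *)
Definition colour_group : {set 'S_N} :=
  [set s : 'S_N | [forall i, c (s i) == c i]].

Lemma colour_groupP s : reflect (forall i, c (s i) = c i) (s \in colour_group).
Proof. by rewrite inE; apply: (iffP forallP) => cs i; apply/eqP/cs. Qed.

Fact colour_group_set : group_set colour_group.
Proof.
apply/group_setP; split=> [|s t /colour_groupP cs /colour_groupP ct].
  by apply/colour_groupP => i; rewrite perm1.
by apply/colour_groupP => i; rewrite permM ct cs.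
Qed.

Canonical colour_grp := group colour_group_set.

Lemma setactPE A s : ('P^*)%act A s = s @: A.
Proof. by []. Qed.

Lemma mem_imset_perm A s i : (s i \in s @: A) = (i \in A).
Proof. by rewrite mem_imset //; apply: perm_inj. Qed.

(** Recolouring each point by the pair of its colour and its membership in A
    (or B), a colour-preserving permutation that carries A to B is a permutation
    matching these two finer colourings. *)
Lemma colour_orbitP A B :
  reflect (forall x, #|[set i in A | c i == x]| = #|[set i in B | c i == x]|)
          (B \in orbit 'P^* colour_group A).
Proof.
apply: (iffP orbitP) => [[s /colour_groupP cs <-] x | AB].
  rewrite setactPE -(card_imset _ (@perm_inj _ s)); apply: eq_card => j.
  rewrite -(permKV s j) !inE mem_imset_perm (mem_imset _ _ (@perm_inj _ s)).
  by rewrite !inE cs.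
have cardC x (E : {set 'I_N}) :
    #|[set i | (c i == x) && (i \in E)]| +
    #|[set i | (c i == x) && (i \notin E)]| = #|[set i | c i == x]|.
  rewrite -[RHS](cardsID E) (setIC _ E); congr (_ + _); apply: eq_card => i;
    by rewrite !inE andbC.
have [[x []]|s sE] :=
  @perm_of_fibers _ (fun i => (c i, i \in A)) (fun i => (c i, i \in B)).
- have eA (E : {set 'I_N}) :
      [set i | (c i, i \in E) == (x, true)] = [set i in E | c i == x].
    by apply/setP => i; rewrite !inE xpair_eqE eqb_id andbC.
  by rewrite !eA AB.
- have eA (E : {set 'I_N}) : [set i | (c i, i \in E) == (x, false)]
       = [set i | (c i == x) && (i \notin E)].
    by apply/setP => i; rewrite !inE xpair_eqE eqbF_neg.
  rewrite !eA; have:= cardC x A; rewrite -(cardC x B).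
  have eB (E : {set 'I_N}) :
      [set i | (c i == x) && (i \in E)] = [set i in E | c i == x].
    by apply/setP => i; rewrite !inE andbC.
  by rewrite !eB AB => /addnI.
exists s; first by apply/colour_groupP => i; case: (sE i).
rewrite setactPE; apply/setP => j; rewrite -(permKV s j) mem_imset_perm.
by case: (sE (s^-1%g j)).
Qed.

End ColourGroup.

(** * Permutation characters on subsets *)

Section SubsetCharacters.

Variable N : nat.
Implicit Types (A B : {set 'I_N}) (s : 'S_N).

Lemma mem_setact_stab B s :
  (s \in colour_group (fun i => i \in B)) = (s @: B == B).
Proof.
apply/colour_groupP/eqP => [Bs | sB i]; last by rewrite -{1}sB mem_imset_perm.
by apply/setP => j; rewrite -(permKV s j) mem_imset_perm Bs.
Qed.

Lemma orbit_perm B A : (A \in orbit 'P^* [set: 'S_N] B) = (#|A| == #|B|).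
Proof.
have setTE : [set: 'S_N] = colour_group (fun _ : 'I_N => tt).
  by apply/setP => s; rewrite inE; apply/esym/colour_groupP.
have eE (E : {set 'I_N}) : [set i in E | tt == tt] = E.
  by apply/setP => i; rewrite inE andbT.
rewrite [X in orbit _ X _]setTE.
apply/colour_orbitP/eqP => [/(_ tt) | AB []]; by rewrite !eE.
Qed.

(** The permutation character on subsets of size #|B|, written as an induced
    character so that Frobenius reciprocity applies. *)
Definition subset_char B : 'CF([set: 'S_N]%G) :=
  'Ind[[set: 'S_N]%G, colour_grp (fun i => i \in B)] 1.

Lemma subset_char_char B : subset_char B \is a character.
Proof. by rewrite cfInd_char ?rpred1. Qed.

Lemma subset_charE B s :
  subset_char B s = #|[set A : {set 'I_N} | (#|A| == #|B|) && (s @: A == A)]|%:R.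
Proof.
rewrite cfIndE ?subsetT // (reindex_inj invg_inj) /=.
under eq_bigl => y do rewrite inE -(in_setT y).
have stabJ y : ((s ^ y^-1)%g \in colour_grp (fun i => i \in B)) =
               (s @: (('P^*)%act B y) == ('P^*)%act B y).
  rewrite [LHS]mem_setact_stab -setactPE conjgE invgK !actM.
  rewrite -(inj_eq (act_inj 'P^* y)) actKV.
  by [].
under eq_bigr => y _ do rewrite cfun1E stabJ.
rewrite (sum_act 'P^* [set: 'S_N]%G (fun A => (s @: A == A)%:R)).
have -> : #|('C_([set: 'S_N]%G)[B | 'P^*])%g| = #|colour_grp (fun i => i \in B)|.
  apply: eq_card => t; rewrite [RHS]mem_setact_stab inE in_setT /=.
  by rewrite !inE sub1set inE.
rewrite sumrMnl -[X in _ * X]mulr_natl mulKf ?pnatr_eq0 -?lt0n ?cardG_gt0 //.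
rewrite -sum1_card natr_sum big_mkcond [RHS]big_mkcond /=.
by apply: eq_bigr => A _; rewrite orbit_perm inE; do 2!case: eqP.
Qed.

Lemma cfdot_subset_char B (phi : 'CF([set: 'S_N]%G)) :
  '[subset_char B, phi] =
    #|colour_grp (fun i => i \in B)|%:R^-1 *
    \sum_(s in colour_grp (fun i => i \in B)) (phi s)^*.
Proof.
rewrite -Frobenius_reciprocity cfdotE; congr (_ * _); apply: eq_bigr => s Hs.
by rewrite cfResE ?subsetT // cfun1E Hs mul1r.
Qed.

Lemma card_imset_ker (T U V : finType) (f : T -> U) (g : T -> V) (S : {set T}) :
  {in S &, forall x y, (f x == f y) = (g x == g y)} -> #|f @: S| = #|g @: S|.
Proof.
move=> fg; have [-> | [x0 Sx0]] := set_0Vmem S; first by rewrite !imset0 !cards0.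
pose h u := odflt x0 [pick x in S | f x == u].
have hP x : x \in S -> (h (f x) \in S) /\ f (h (f x)) = f x.
  rewrite /h => Sx; case: pickP => [y /andP[Sy /eqP fy] // | /(_ x)].
  by rewrite /= Sx eqxx.
have -> : g @: S = (g \o h) @: (f @: S).
  rewrite -imset_comp; apply: eq_in_imset => x Sx /=.
  by have [Sh fh] := hP x Sx; apply/eqP; rewrite -fg // fh.
rewrite [RHS]card_in_imset // => _ _ /imsetP[x Sx ->] /imsetP[y Sy ->] /= /eqP.
have [[Shx fx] [Shy fy]] := (hP x Sx, hP y Sy).
by rewrite -fg // fx fy => /eqP.
Qed.

Lemma subset_of_card (T : finType) (A : {set T}) k :
  (k <= #|A|)%N -> exists2 B : {set T}, B \subset A & #|B| = k.
Proof.
rewrite -bin_gt0 -cards_draws => /card_gt0P[B].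
by rewrite inE => /andP[sBA /eqP]; exists B.
Qed.

(** By Burnside this counts the orbits of the stabiliser of A on the subsets of
    size #|B|; such an orbit is determined by the size of the intersection with
    A, which takes all values from 0 to #|A|. *)
Lemma cfdot_subset_chars A B :
    (#|A| <= #|B|)%N -> (#|A| + #|B| <= N)%N ->
  '[subset_char A, subset_char B] = #|A|.+1%:R.
Proof.
move=> leAB leN; pose H := colour_grp (fun i => i \in A).
pose S := [set E : {set 'I_N} | #|E| == #|B|].
have actsS : [acts H, on S | 'P^*].
  apply/subsetP => s Hs; rewrite !inE /=; apply/subsetP => E.
  by rewrite !inE setactPE card_imset //; apply: perm_inj.
rewrite cfdot_subset_char.
have -> : \sum_(s in H) (subset_char B s)^* =
          (\sum_(s in H) #|('Fix_(S | 'P^*)[s])%g|)%:R.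
  rewrite natr_sum; apply: eq_bigr => s _; rewrite subset_charE conjC_nat.
  by congr _%:R; apply: eq_card => E; rewrite !inE sub1set inE.
rewrite (Frobenius_Cauchy actsS) natrM mulrC mulfK ?pnatr_eq0 -?lt0n ?cardG_gt0 //.
congr _%:R; pose f (E : {set 'I_N}) : 'I_(#|A|.+1) := inord #|E :&: A|.
have fE E : f E = #|E :&: A| :> nat.
  by rewrite inordK // ltnS subset_leq_card ?subsetIr.
have cardE (E : {set 'I_N}) b :
    #|[set i in E | (i \in A) == b]| =
    if b then #|E :&: A| else (#|E| - #|E :&: A|)%N.
  case: b; first by apply: eq_card => i; rewrite !inE eqb_id.
  rewrite -(cardsID A E) addKn; apply: eq_card => i.
  by rewrite !inE eqbF_neg andbC.
rewrite (@card_imset_ker _ _ _ _ f); last first.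
  move=> E E'; rewrite !inE => /eqP cE /eqP cE'.
  rewrite eq_sym (sameP eqP orbit_eqP).
  apply/colour_orbitP/eqP => [/(_ true) | /(congr1 val)/=].
    by rewrite !cardE => EE; apply: val_inj; rewrite /= !fE.
  by rewrite !fE => EE b; rewrite !cardE EE cE cE'.
have -> : f @: S = setT.
  apply/setP => x; rewrite inE; apply/imsetP.
  (* x points of A together with #|B| - x points outside A *)
  have [X sXA cX] := @subset_of_card _ A x (ltn_ord x).
  have [|Y sYA cY] := @subset_of_card _ (~: A) (#|B| - x).
    by have := cardsC A; rewrite card_ord; have := ltn_ord x; lia.
  have dXY : [disjoint X & Y].
    rewrite disjoints_subset; apply: subset_trans sXA _.
    by rewrite -disjoints_subset disjoint_sym disjoints_subset.
  exists (X :|: Y).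
    rewrite inE cardsU disjoint_setI0 // cards0 cX cY.
    by have ltx := ltn_ord x; apply/eqP; lia.
  apply: val_inj; rewrite /= fE setIUl (setIidPl sXA).
  by rewrite (disjoint_setI0 (_ : [disjoint Y & A])) ?setU0 ?cX ?disjoints_subset.
by rewrite cardsT card_ord.
Qed.

End SubsetCharacters.

(** * Right ideals of the group algebra *)

Section GroupRing.

Variables (gT : finGroupType) (G : {group gT}).

Local Notation aG := (regular_repr algC G).

Definition gring_basis (x : gT) : 'rV[algC]_#|G| := delta_mx 0 (gring_index G x).

Lemma gring_basisM x g : x \in G -> gring_basis x *m aG g = gring_basis (x * g)%g.
Proof. by move=> Gx; rewrite -rowE rowK gring_indexK. Qed.

(** L is a projection onto the row space of U that acts first, so on a
    complement of U it contributes nothing to the trace. *)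
Lemma mxtrace_submod_proj n (rG : mx_representation algC G n) (U L : 'M_n)
    (modU : mxmodule rG U) x :
    x \in G -> (L <= U)%MS -> U *m L = U ->
  \tr (submod_repr modU x) = \tr (L *m rG x).
Proof.
move=> Gx sLU UL; pose B := val_submod (1%:M : 'M_(\rank U)).
have BL : B *m L = B.
  have /submxP[W ->] : (B <= U)%MS by rewrite val_submodP.
  by rewrite -mulmxA UL.
have BX : B *m in_submod U L = 1%:M.
  by rewrite in_submodE mulmxA BL -in_submodE val_submodK.
have defL : L = in_submod U L *m B by rewrite -val_submodE in_submodK.
rewrite {1}defL -mulmxA [RHS]mxtrace_mulC -(val_submodJ modU) // mul1mx.
rewrite [val_submod _]val_submodE -/B.
by rewrite -mulmxA BX mulmx1.
Qed.

Lemma cyclic_mx_annihilated n (rG : mx_representation algC G n) u m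
    (W : 'M_(m, n)) p (Z : 'M_(n, p)) :
    {in G, forall g, u *m rG g *m Z = 0} -> (W <= cyclic_mx rG u)%MS ->
  W *m Z = 0.
Proof.
move=> uZ sWu; apply/row_matrixP => i; rewrite row_mul row0.
have /cyclic_mxP[A /envelop_mxP[c ->] ->] := submx_trans (row_sub i W) sWu.
rewrite mulmx_sumr mulmx_suml big1 // => g Gg.
by rewrite -scalemxAr -scalemxAl uZ ?scaler0.
Qed.

(** The quotient of the larger submodule by the smaller one affords the
    complementary character. *)
Lemma cfRepr_submod_sub n (rG : mx_representation algC G n) (U V : 'M_n)
    (modU : mxmodule rG U) (modV : mxmodule rG V) :
    (U <= V)%MS ->
  exists2 theta, theta \is a character
    & cfRepr (submod_repr modV) = cfRepr (submod_repr modU) + theta.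
Proof.
move=> sUV; have [modU' simU] := mx_rsim_in_submod modU modV sUV.
exists (cfRepr (factmod_repr modU')); first exact: cfRepr_char.
rewrite (cfRepr_sim simU); apply/cfun_inP => x Gx; rewrite !cfunE Gx !mulr1n.
by rewrite mxtrace_sub_fact_mod.
Qed.

(** Left multiplication by the average of H projects the group ring onto this
    right ideal and commutes with right multiplication; the trace of right
    multiplication by g on the ideal then counts the x with g fixing the coset
    H x. *)
Lemma cfRepr_coset_module (H : {group gT}) :
    H \subset G ->
  cfRepr (submod_repr
    (cyclic_mx_module aG (\sum_(h in H) gring_basis h))) = 'Ind[G, H] 1.
Proof.
move=> sHG; have HG h : h \in H -> h \in G by apply: (subsetP sHG).
set a := \sum_(h in H) _; have nzH : #|H|%:R != 0 :> algC.
  by rewrite pnatr_eq0 -lt0n cardG_gt0.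
have ag g : g \in G -> a *m aG g = \sum_(h in H) gring_basis (h * g)%g.
  by move=> Gg; rewrite mulmx_suml; apply: eq_bigr => h /HG Gh; rewrite gring_basisM.
have ah h : h \in H -> a *m aG h = a.
  move=> Hh; rewrite ag ?HG // [RHS](reindex_inj (mulIg h)) /=.
  by apply: eq_bigl => h'; rewrite groupMr.
(* left multiplication by the average of H: row x is the average of the h x *)
pose L : 'M_#|G| := \matrix_i (#|H|%:R^-1 *: (a *m aG (enum_val i))).
have bL x : x \in G -> gring_basis x *m L = #|H|%:R^-1 *: (a *m aG x).
  by move=> Gx; rewrite -rowE rowK gring_indexK.
have sLU : (L <= cyclic_mx aG a)%MS.
  apply/row_subP => i; rewrite rowK scalemx_sub //.
  exact: mxmodule_trans (cyclic_mx_module _ _) (enum_valP i) (cyclic_mx_id _ _).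
have UL : cyclic_mx aG a *m L = cyclic_mx aG a.
  apply/eqP; rewrite -subr_eq0 -[X in _ - X]mulmx1 -mulmxBr; apply/eqP.
  apply: (@cyclic_mx_annihilated _ _ a) => // g Gg.
  rewrite mulmxBr mulmx1; apply/eqP; rewrite subr_eq0; apply/eqP.
  rewrite {1}ag // mulmx_suml (eq_bigr (fun=> #|H|%:R^-1 *: (a *m aG g))).
    by rewrite sumr_const -scaler_nat scalerA mulfV ?scale1r.
  move=> h Hh; have Gh := HG h Hh.
  by rewrite bL ?groupM // (repr_mxM aG Gh Gg) mulmxA ah.
apply/cfun_inP => g Gg; rewrite cfunE Gg mulr1n (mxtrace_submod_proj _ Gg sLU UL).
rewrite cfIndE // mulr_sumr (reindex_inj invg_inj) /=.
under [RHS]eq_bigl => x do rewrite groupV.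
rewrite /mxtrace (reindex_onto (gring_index G) (@enum_val _ (mem G))) /=; last first.
  by move=> i _; rewrite gring_valK.
rewrite (eq_bigl (mem G)) => [|x]; last first.
  by apply/eqP/idP => [<- | Gx]; [apply: enum_valP | apply: gring_indexK].
apply: eq_bigr => x Gx; rewrite cfun1E.
rewrite (_ : (L *m aG g) _ _ =
  row (gring_index G x) (L *m aG g) 0 (gring_index G x)); last first.
  by rewrite [RHS]mxE.
rewrite row_mul rowK gring_indexK // -scalemxAl -mulmxA -repr_mxM //.
rewrite (ag _ (groupM Gx Gg)).
rewrite mxE summxE; congr (_ * _).
rewrite (eq_bigr (fun h => (h == (g^-1 ^ x^-1)%g)%:R)) => [|h Hh].
  have -> : (g ^ x^-1 \in H)%g = ((g^-1 ^ x^-1)%g \in H) by rewrite conjVg groupV.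
  have [Hz | nHz] := boolP ((g^-1 ^ x^-1)%g \in H).
    rewrite (bigD1 _ Hz) /= eqxx big1 ?addr0 // => h /andP[_ /negbTE-> //].
  by rewrite big1 // => h Hh; case: eqP nHz => // <-; rewrite Hh.
rewrite mxE eqxx /=; congr (nat_of_bool _)%:R.
have Gh := HG h Hh.
rewrite (can_in_eq (@gring_indexK _ G)) ?(groupM Gh (groupM Gx Gg)) //.
by rewrite conjgE invgK -invMg eq_sym (can2_eq (mulgK _) (mulgKV _)).
Qed.

End GroupRing.

(** * The Specht module of a two-row shape *)

Section TwoRowSpecht.

Variables (N k : nat).
Hypothesis le_2k_N : (2 * k <= N)%N.

Let G := [set: 'S_N]%G.
Let tau := [:: (N - k)%N; k].
Let aG := regular_repr algC G.

Lemma reshape_index_two_rows i : (i < N)%N -> reshape_index tau i = (N - k <= i)%N.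
Proof.
move=> ltiN; rewrite /reshape_index /= !subn_eq0 ltnNge.
have -> : (i.+1 - (N - k) <= k)%N by lia.
by case: (N - k <= i)%N.
Qed.

Lemma reshape_offset_two_rows i :
  (i < N)%N -> reshape_offset tau i = if (N - k <= i)%N then (i - (N - k))%N else i.
Proof.
move=> ltiN; rewrite /reshape_offset reshape_index_two_rows //.
by case: leqP => _ /=; rewrite ?addn0 ?subn0.
Qed.

Definition second_row : {set 'I_N} := [set i : 'I_N | (N - k <= i)%N].

Lemma card_second_row : #|second_row| = k.
Proof.
have sub i : (N - k + nat_of_ord (i : 'I_k) < N)%N by have := ltn_ord i; lia.
pose f i := Ordinal (sub i).
have inj_f : injective f by move=> i j /(congr1 val)/= /addnI/val_inj.
rewrite -[RHS]card_ord -(card_imset _ inj_f); apply: eq_card => i.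
rewrite inE; apply/idP/imsetP => [le | [j _ ->]]; last by rewrite /= leq_addr.
have lt : (i - (N - k) < k)%N by have := ltn_ord i; lia.
by exists (Ordinal lt) => //; apply: val_inj; rewrite /= subnKC.
Qed.

Let R := colour_grp (fun i => i \in second_row).
Let C := colour_grp (fun i : 'I_N => reshape_offset tau i).

Lemma row_stabiliser_two_rows : row_stabiliser N tau = R.
Proof.
apply/setP => s; rewrite !inE; apply: eq_forallb => i.
by rewrite !reshape_index_two_rows // !inE; do 2!case: (N - k <= _)%N.
Qed.

Lemma young_symmetrizer_two_rows :
  young_symmetrizer N tau =
  \sum_(p in R) \sum_(q in C) (-1) ^+ odd_perm q *: gring_basis G (p * q)%g.
Proof. by rewrite /young_symmetrizer row_stabiliser_two_rows. Qed.

(** The coefficient of the identity is 1, since only the identity preserves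
    both rows and columns. *)
Lemma young_symmetrizer_neq0 : young_symmetrizer N tau != 0.
Proof.
apply/eqP => /(congr1 (fun u : 'rV_#|G| => u 0 (gring_index G 1%g))).
rewrite young_symmetrizer_two_rows summxE (bigD1 1%g) ?group1 //=.
rewrite [X in _ + X]big1 => [|p].
  rewrite addr0 summxE (bigD1 1%g) ?group1 //= [X in _ + X]big1 => [|q].
    rewrite addr0 odd_perm1 scale1r !mxE mulg1 !eqxx /= => /eqP.
    by rewrite oner_eq0.
  case/andP=> _ nt_q; rewrite !mxE mul1g eqxx /=.
  rewrite (can_in_eq (@gring_indexK _ G)) ?inE // eq_sym (negbTE nt_q).
  by rewrite mulr0.
case/andP=> Rp nt_p; rewrite summxE big1 // => q Cq; rewrite !mxE eqxx /=.
rewrite (can_in_eq (@gring_indexK _ G)) ?inE // eq_sym.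
case: eqP => [pq1 | _]; last by rewrite mulr0.
case/eqP: nt_p; apply/permP => i; rewrite perm1.
have Cp : p \in C by rewrite -(mulgK q p) pq1 mul1g groupV.
have:= colour_groupP _ _ Cp i; have:= colour_groupP _ _ Rp i.
rewrite !inE /= !reshape_offset_two_rows // => pR; rewrite pR.
case: ifP => le eq_pi; apply: val_inj => //.
by have:= congr1 (addn (N - k)) eq_pi; rewrite !subnKC ?pR.
Qed.

(** Otherwise each of the k columns of length two would have exactly one end
    carried into T by g, giving k distinct points of T. *)
Lemma column_with_equal_membership (g : 'S_N) (T : {set 'I_N}) :
    (#|T| < k)%N ->
  exists x y : 'I_N, [/\ x != y, reshape_offset tau x = reshape_offset tau y
                       & (g x \in T) = (g y \in T)].
Proof.
move=> ltT; have subx i : (nat_of_ord (i : 'I_k) < N)%N by have := ltn_ord i; lia.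
have suby i : (N - k + nat_of_ord (i : 'I_k) < N)%N by have := ltn_ord i; lia.
pose x i := Ordinal (subx i); pose y i := Ordinal (suby i).
have xE i : reshape_offset tau (x i) = i.
  by rewrite reshape_offset_two_rows //= ifN //; have := ltn_ord i; lia.
have yE i : reshape_offset tau (y i) = i.
  by rewrite reshape_offset_two_rows //= leq_addr addKn.
have [/existsP[i /eqP Ti] | /existsPn nT] :=
  boolP [exists i, (g (x i) \in T) == (g (y i) \in T)].
  exists (x i), (y i); split; rewrite ?xE ?yE //.
  by rewrite -val_eqE /=; have := ltn_ord i; apply/contraTneq => ?; lia.
pose f i := if g (x i) \in T then x i else y i.
have inj_f : injective (g \o f).
  move=> i j /perm_inj /(congr1 (fun z : 'I_N => reshape_offset tau z)).
  have fE l : reshape_offset tau (f l) = l by rewrite /f; case: ifP.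
  by rewrite !fE => /val_inj.
have: (#|[set: 'I_k]| <= #|T|)%N.
  rewrite -(card_imset _ inj_f); apply/subset_leq_card/subsetP => _ /imsetP[i _ ->].
  rewrite /= /f; case: ifP => // nTx; move: (nT i); rewrite nTx.
  by case: (g (y i) \in T).
by rewrite cardsT card_ord leqNgt ltT.
Qed.

(** With t the transposition of such a column, replacing q by q t and h by
    (t ^ g)^-1 h leaves each product p q g h unchanged and reverses the sign, so
    the sum equals its opposite. *)
Lemma young_symmetrizer_average (g : 'S_N) (T : {set 'I_N}) :
    (#|T| < k)%N ->
  young_symmetrizer N tau *m aG g
    *m (\sum_(h in colour_grp (fun i => i \in T)) aG h) = 0.
Proof.
move=> ltT; set H := colour_grp _.
have [x [y [neq_xy Cxy Txy]]] := column_with_equal_membership g ltT.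
pose t := tperm x y.
have Ct : t \in C.
  by apply/colour_groupP => i; rewrite /t; case: tpermP => // ->.
have Htg : (t ^ g)%g \in H.
  by rewrite /t tpermJ; apply/colour_groupP => i; case: tpermP => // ->.
rewrite young_symmetrizer_two_rows !mulmx_suml big1 // => p Rp.
rewrite !mulmx_suml.
pose X := \sum_(q in C) (-1) ^+ odd_perm q *:
  (\sum_(h in H) gring_basis G (p * q * g * h)%g).
transitivity X.
  apply: eq_bigr => q _; rewrite -!scalemxAl mulmx_sumr; congr (_ *: _).
  apply: eq_bigr => h _.
  by rewrite !gring_basisM ?inE.
have: X = - X.
  rewrite {1}/X (reindex_inj (mulIg t)) /= /X -sumrN.
  apply: eq_big => [q | q Cq]; first by rewrite groupMr.
  rewrite odd_permM odd_tperm neq_xy /= addbT signrN scaleNr; congr (- (_ *: _)).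
  rewrite (reindex_inj (mulgI ((t ^ g)^-1)%g)) /=.
  apply: eq_big => [h | h Hh]; first by rewrite groupMl ?groupV.
  by congr (gring_basis _ _); rewrite conjgE !invMg invgK !mulgA !mulgK.
move/eqP; rewrite -subr_eq0 opprK -mulr2n -scaler_nat scaler_eq0 pnatr_eq0 /=.
by move/eqP.
Qed.

Let chi := Defs.irr_char N tau.

Lemma specht_char : chi \is a character.
Proof. exact: cfRepr_char. Qed.

Lemma specht_neq0 : chi != 0.
Proof.
apply/eqP => /(congr1 (fun f : 'CF(G) => f 1%g)); rewrite cfRepr1 cfunE => /eqP.
rewrite pnatr_eq0 mxrank_eq0 cyclic_mx_eq0.
exact/negP/young_symmetrizer_neq0.
Qed.

(** By Frobenius reciprocity the product is the trace of the averaging operator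
    over the stabiliser of T, which vanishes on the Specht module. *)
Lemma cfdot_specht_lower (T : {set 'I_N}) :
  (#|T| < k)%N -> '[chi, subset_char T] = 0.
Proof.
move=> ltT; rewrite cfdotC_char ?specht_char ?subset_char_char //.
rewrite cfdot_subset_char -rmorph_sum; set H := colour_grp _.
suff -> : \sum_(s in H) chi s = 0 by rewrite rmorph0 mulr0.
pose U := cyclic_mx aG (young_symmetrizer N tau).
pose Z := \sum_(h in H) aG h.
transitivity (\tr (in_submod U (val_submod (1%:M : 'M_(\rank U)) *m Z))).
  rewrite mulmx_sumr !raddf_sum; apply: eq_bigr => s _.
  by rewrite cfunE inE mulr1n.
rewrite (@cyclic_mx_annihilated _ _ _ aG (young_symmetrizer N tau));
  rewrite ?val_submodP ?linear0 ?mxtrace0 //.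
by move=> g _; apply: young_symmetrizer_average.
Qed.

(** The Young symmetrizer is a combination of right translates of the sum of the
    row stabiliser, so the Specht module lies in the coset module. *)
Lemma specht_sub_subset_char :
  exists2 theta, theta \is a character & subset_char second_row = chi + theta.
Proof.
rewrite /subset_char -cfRepr_coset_module ?subsetT //.
apply: cfRepr_submod_sub; apply: cyclic_mx_sub; first exact: cyclic_mx_module.
set a := \sum_(h in _) _.
have -> : young_symmetrizer N tau =
          \sum_(q in C) (-1) ^+ odd_perm q *: (a *m aG q).
  rewrite young_symmetrizer_two_rows exchange_big; apply: eq_bigr => q _.
  rewrite mulmx_suml scaler_sumr; apply: eq_bigr => p _.
  by rewrite gring_basisM ?inE.
apply: summx_sub => q _; apply: scalemx_sub.
apply: mxmodule_trans (cyclic_mx_module _ _) _ (cyclic_mx_id _ _).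
by rewrite inE.
Qed.

End TwoRowSpecht.

(** * Identification of the two-row character *)

(** A virtual character pi - pi' of norm 1 is plus or minus an irreducible
    character, and its product with pi decides the sign.  Any other irreducible
    constituent of chi would be one of pi, hence of pi', against
    orthogonality; and pi contains this irreducible character once. *)
Lemma character_of_difference (gT : finGroupType) (G : {group gT})
    (chi theta pi pi' : 'CF(G)) :
    chi \is a character -> theta \is a character ->
    pi \is a character -> pi' \is a character ->
    chi != 0 -> pi = chi + theta -> '[chi, pi'] = 0 ->
    '[pi - pi'] = 1 -> '[pi, pi - pi'] = 1 ->
  chi = pi - pi'.
Proof.
move=> Nchi Ntheta Npi Npi' nz_chi def_pi chi_pi' norm1 pi_psi.
have Zpsi : pi - pi' \in ('Z[irr G])%g by rewrite rpredB ?char_vchar.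
have [b [i def_psi]] := vchar_norm1P Zpsi norm1.
have pos (phi : 'CF(G)) j : phi \is a character -> 0 <= '[phi, 'chi_j].
  by move=> Nphi; rewrite natr_ge0 ?Cnat_cfdot_char_irr.
have b0 : b = false.
  apply/negP => b1; have := pos pi i Npi.
  suff -> : '[pi, 'chi_i] = -1 by rewrite oppr_ge0 ler10.
  by rewrite -pi_psi def_psi b1 expr1 scaleN1r cfdotNr opprK.
have {b b0 def_psi} def_psi : pi - pi' = 'chi_i by rewrite def_psi b0 expr0 scale1r.
have chi_j j : j != i -> '[chi, 'chi_j] = 0.
  move=> neq_ji; apply/eqP/negPn/negP => nz_j.
  have pi'_j : '[pi', 'chi_j] = 0.
    have /eqP := chi_pi'; rewrite cfdot_char_r // psumr_eq0 => [/allP/(_ j)|l _].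
      by rewrite mem_index_enum mulf_eq0 (negbTE nz_j) => /(_ isT)/eqP.
    by rewrite mulr_ge0 ?pos.
  have /eqP : '[pi, 'chi_j] = 0.
    rewrite -(subrK pi' pi) def_psi cfdotDl pi'_j addr0 cfdot_irr eq_sym.
    by rewrite (negbTE neq_ji).
  by rewrite def_pi cfdotDl paddr_eq0 ?pos // (negbTE nz_j).
have def_chi : chi = '[chi, 'chi_i] *: 'chi_i.
  rewrite {1}[chi]cfun_sum_cfdot (bigD1 i) //= big1 ?addr0 // => j /chi_j ->.
  by rewrite scale0r.
have /natrP[c def_c] := Cnat_cfdot_char_irr i Nchi.
rewrite def_psi def_chi def_c.
have c_gt0 : (0 < c)%N.
  by rewrite lt0n; apply: contraNneq nz_chi => c0; rewrite def_chi def_c c0 scale0r.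
have: c%:R <= 1 :> algC.
  rewrite -def_c -pi_psi def_psi def_pi cfdotDl lerDl pos //.
rewrite -[1]/(1%:R) ler_nat => c_le1.
by rewrite (_ : c = 1%N) ?scale1r //; apply/eqP; rewrite eqn_leq c_le1.
Qed.

Lemma irr_char_two_rows (N k : nat) (B : {set 'I_N}) :
    (0 < k)%N -> (2 * k <= N)%N -> (#|B| = k.-1)%N ->
  Defs.irr_char N [:: (N - k)%N; k] =
    subset_char (second_row N k) - subset_char B.
Proof.
move=> k_gt0 le_2k_N cardB.
have [theta Ntheta def_pi] := specht_sub_subset_char le_2k_N.
have cardA := card_second_row le_2k_N.
have AA : '[subset_char (second_row N k)] = k.+1%:R.
  by rewrite cfdot_subset_chars ?cardA //; lia.
have BA : '[subset_char B, subset_char (second_row N k)] = k%:R.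
  by rewrite cfdot_subset_chars ?cardA ?cardB ?prednK //; lia.
have BB : '[subset_char B] = k%:R.
  by rewrite cfdot_subset_chars ?cardB ?prednK //; lia.
have AB : '[subset_char (second_row N k), subset_char B] = k%:R.
  by rewrite cfdotC_char ?subset_char_char.
apply: (character_of_difference _ Ntheta) def_pi _ _ _;
  rewrite ?subset_char_char ?specht_char ?specht_neq0 //.
- by rewrite cfdot_specht_lower // cardB; lia.
- by rewrite cfdotBl !cfdotBr AA AB BA BB -(natr1 k); ring.
- by rewrite cfdotBr AA AB -(natr1 k); ring.
Qed.

(** * Averages over the coset of the 3-cycle *)

Section YoungAverage.

Variables n1 n2 n3 : nat.
Let N := (n1 + n2 + n3)%N.

Implicit Types (A : {set 'I_N}) (s : 'S_N).

Definition block (i : 'I_N) : nat :=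
  if (i < n1)%N then 0%N else if (i < n1 + n2)%N then 1%N else 2%N.

Definition block_set (j : nat) : {set 'I_N} := [set i | block i == j].

Lemma block_sets :
  [/\ I1 n1 n2 n3 = block_set 0, I2 n1 n2 n3 = block_set 1
    & I3 n1 n2 n3 = block_set 2].
Proof. by split; apply/setP => i; rewrite !inE /block;
  case: (ltnP i n1) => ?; case: (ltnP i (n1 + n2)) => ? //=; lia. Qed.

Lemma block_lt3 i : (block i < 3)%N.
Proof. by rewrite /block; do 2?case: ifP. Qed.

Lemma card_block_sets :
  [/\ #|block_set 0| = n1, #|block_set 1| = n2 & #|block_set 2| = n3].
Proof.
have card_lt m : (m <= N)%N -> #|[set i : 'I_N | (i < m)%N]| = m.
  move=> lemN; have inj_w : injective (widen_ord lemN).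
    by move=> i j /(congr1 val)/= /val_inj.
  rewrite -[RHS]card_ord -(card_imset _ inj_w).
  apply: eq_card => i; rewrite inE; apply/idP/imsetP => [lt | [j _ ->]] //=.
  by exists (Ordinal lt) => //; apply: val_inj.
have c0 : block_set 0 = [set i : 'I_N | (i < n1)%N].
  by apply/setP => i; rewrite !inE /block;
    case: (ltnP i n1) => ?; case: (ltnP i (n1 + n2)) => ? //=; lia.
have c01 : block_set 0 :|: block_set 1 = [set i : 'I_N | (i < n1 + n2)%N].
  by apply/setP => i; rewrite !inE /block;
    case: (ltnP i n1) => ?; case: (ltnP i (n1 + n2)) => ? //=; lia.
have c012 : (block_set 0 :|: block_set 1) :|: block_set 2 =
            [set i : 'I_N | (i < N)%N].
  by apply/setP => i; rewrite !inE /block ltn_ord; do 2?case: ifP.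
have d01 : block_set 0 :&: block_set 1 = set0.
  by apply/setP => i; rewrite !inE /block;
    case: (ltnP i n1) => ?; case: (ltnP i (n1 + n2)) => ? //=; lia.
have d012 : (block_set 0 :|: block_set 1) :&: block_set 2 = set0.
  by apply/setP => i; rewrite !inE /block;
    case: (ltnP i n1) => ?; case: (ltnP i (n1 + n2)) => ? //=; lia.
have le1 : (n1 <= N)%N by rewrite /N; lia.
have le2 : (n1 + n2 <= N)%N by rewrite /N; lia.
have e0 := card_lt _ le1; have e1 := card_lt _ le2.
have e2 := card_lt N (leqnn N).
rewrite -c0 in e0; rewrite -c01 cardsU d01 cards0 subn0 in e1.
rewrite -c012 cardsU d012 cards0 subn0 cardsU d01 cards0 subn0 in e2.
have {}e2 := etrans e2 (erefl (n1 + n2 + n3)%N).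
rewrite e1 in e2; rewrite e0 in e1.
by split; [| apply: addnI e1 | apply: addnI e2].
Qed.

Lemma young_subgroupE : young_subgroup n1 n2 n3 = colour_grp block.
Proof.
rewrite /young_subgroup; have [-> -> ->] := block_sets.
apply/setP => s; rewrite inE.
apply/and3P/colour_groupP => [[/eqP s0 /eqP s1 /eqP s2] i | sB].
  have blockP j : s @: block_set j = block_set j ->
      (block (s i) == j) = (block i == j).
    by move=> sj; have := mem_imset_perm (block_set j) s i; rewrite sj !inE.
  have := blockP 0%N s0; have := blockP 1%N s1; have := blockP 2%N s2.
  by have := block_lt3 i; have := block_lt3 (s i); lia.
have sE j : s @: block_set j == block_set j.
  apply/eqP/setP => i; rewrite -(permKV s i) mem_imset_perm !inE.
  by rewrite sB.
by split.
Qed.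

Let V := ('I_n1.+1 * 'I_n2.+1 * 'I_n3.+1)%type.

Definition block_type A : V :=
  (inord #|A :&: block_set 0|, inord #|A :&: block_set 1|,
   inord #|A :&: block_set 2|).

Lemma block_typeE A (v : V) : (block_type A == v) =
  [&& #|A :&: block_set 0| == v.1.1, #|A :&: block_set 1| == v.1.2
    & #|A :&: block_set 2| == v.2 :> nat].
Proof.
have [c0 c1 c2] := card_block_sets.
have le j : (#|A :&: block_set j| <= #|block_set j|)%N.
  by rewrite subset_leq_card ?subsetIr.
case: v => [[v1 v2] v3]; rewrite /block_type !xpair_eqE -!val_eqE /= -andbA.
by rewrite !inordK // ltnS -?c0 -?c1 -?c2.
Qed.

(** The a_j are the full invariants of an orbit of the Young subgroup. *)
Lemma orbit_block A B :
  (B \in orbit 'P^* (colour_grp block) A) = (block_type A == block_type B).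
Proof.
rewrite block_typeE.
have eA (E : {set 'I_N}) j : [set i in E | block i == j] = E :&: block_set j.
  by apply/setP => i; rewrite !inE.
have [c0 c1 c2] := card_block_sets.
have le j (E : {set 'I_N}) : (#|E :&: block_set j| <= #|block_set j|)%N.
  by rewrite subset_leq_card ?subsetIr.
rewrite /= !inordK ?ltnS -?c0 -?c1 -?c2 //.
apply/colour_orbitP/and3P => [AB | [/eqP AB0 /eqP AB1 /eqP AB2] j].
  by split; apply/eqP; rewrite -!eA AB.
rewrite !eA; case: j => [|[|[|j]]] //.
rewrite (_ : block_set j.+3 = set0) ?setI0 //.
by apply/setP => i; rewrite !inE; have := block_lt3 i; lia.
Qed.

Lemma block_type_surj (v : V) : exists A, block_type A = v.
Proof.
have [c0 c1 c2] := card_block_sets; case: v => [[v1 v2] v3].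
have [|X0 sX0 cX0] := @subset_of_card _ (block_set 0) v1.
  by rewrite c0 -ltnS.
have [|X1 sX1 cX1] := @subset_of_card _ (block_set 1) v2.
  by rewrite c1 -ltnS.
have [|X2 sX2 cX2] := @subset_of_card _ (block_set 2) v3.
  by rewrite c2 -ltnS.
exists (X0 :|: X1 :|: X2); apply/eqP; rewrite block_typeE /=.
have b0 i : i \in X0 -> block i = 0%N by move/(subsetP sX0); rewrite inE => /eqP.
have b1 i : i \in X1 -> block i = 1%N by move/(subsetP sX1); rewrite inE => /eqP.
have b2 i : i \in X2 -> block i = 2%N by move/(subsetP sX2); rewrite inE => /eqP.
rewrite -cX0 -cX1 -cX2; apply/and3P; split; apply/eqP/eq_card => i; rewrite !inE.
- case X0i: (i \in X0); first by rewrite b0.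
  by apply/negP; case/andP=> /orP[/b1 | /b2] ->.
- case X1i: (i \in X1); first by rewrite orbT b1.
  by apply/negP; rewrite orbF; case/andP=> /orP[/b0 | /b2] ->.
- case X2i: (i \in X2); first by rewrite orbT b2.
  by apply/negP; rewrite orbF; case/andP=> /orP[/b0 | /b1] ->.
Qed.

Lemma card_block_type A : #|A| =
  (nat_of_ord (block_type A).1.1 + (block_type A).1.2 + (block_type A).2)%N.
Proof.
have := block_typeE A (block_type A).
rewrite eqxx => /esym/and3P[/eqP <- /eqP <- /eqP <-].
rewrite -(cardsID (block_set 0) A).
rewrite -(cardsID (block_set 1) (A :\: block_set 0)) addnA.
congr (_ + _ + _)%N; apply: eq_card => i; rewrite !inE; have := block_lt3 i.
  by case: (i \in A); rewrite ?andbF //=; case: eqP => //= ->.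
by case: (i \in A); rewrite ?andbF //= andbT; lia.
Qed.

(** The number of points inside (b = true) or outside (b = false) a subset of
    size a of a block of n points. *)
Definition side_count (n a : nat) (b : bool) := if b then a else (n - a)%N.

(** Double counting of pairs of a set A of the type v and a triple of points, one
    in each block, all inside A (b = true) or all outside A (b = false): every A
    has the same number of triples, and by transitivity of the Young subgroup on
    triples every triple has the same number of A. *)
Lemma card_triples_in_orbit (v : V) (b : bool) (x0 x1 x2 : 'I_N) :
    block x0 = 0%N -> block x1 = 1%N -> block x2 = 2%N ->
  (n1 * n2 * n3 * #|[set A | block_type A == v &
      [&& (x0 \in A) == b, (x1 \in A) == b & (x2 \in A) == b]]|)%N =
  (side_count n1 v.1.1 b * side_count n2 v.1.2 b * side_count n3 v.2 b
   * #|[set A | block_type A == v]|)%N.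
Proof.
move=> bx0 bx1 bx2; have [c0 c1 c2] := card_block_sets.
pose Y := setX (setX (block_set 0) (block_set 1)) (block_set 2).
pose E A (y : 'I_N * 'I_N * 'I_N) :=
  [&& (y.1.1 \in A) == b, (y.1.2 \in A) == b & (y.2 \in A) == b].
transitivity (\sum_(y in Y) #|[set A | block_type A == v & E A y]|)%N.
  rewrite (eq_bigr (fun=> #|[set A | block_type A == v & E A (x0, x1, x2)]|)).
    by rewrite sum_nat_const !cardsX c0 c1 c2.
  case=> [[y0 y1] y2]; rewrite !inE /= => /andP[/andP[/eqP by0 /eqP by1] /eqP by2].
  (* an element of the Young subgroup carrying the triple x to the triple y *)
  pose s := (tperm x0 y0 * tperm x1 y1 * tperm x2 y2)%g.
  have neq i j : block i <> block j -> i != j by apply: contra_notN => /eqP ->.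
  have s0 : s x0 = y0.
    by rewrite !permM tpermL !tpermD // neq // ?by0 ?by1 ?by2 ?bx0 ?bx1 ?bx2.
  have s1 : s x1 = y1.
    rewrite !permM (@tpermD _ x0) ?tpermL ?tpermD //;
      by rewrite neq // ?by0 ?by1 ?by2 ?bx0 ?bx1 ?bx2.
  have s2 : s x2 = y2.
    rewrite !permM (@tpermD _ x0) ?(@tpermD _ x1) ?tpermL //;
      by rewrite neq // ?by0 ?by1 ?by2 ?bx0 ?bx1 ?bx2.
  have Gs : s \in colour_grp block.
    have tP u w : block u = block w -> tperm u w \in colour_grp block.
      by move=> buw; apply/colour_groupP => i; case: tpermP => // ->.
    by rewrite !groupM // tP // ?by0 ?by1 ?by2.
  rewrite -[RHS](card_imset _ (act_inj 'P^* s)); apply: eq_card => A.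
  rewrite -(actKV 'P^* s A) (mem_imset _ _ (act_inj 'P^* s)) !inE /E /=.
  set B := 'P^*%act A s^-1%g.
  rewrite setactPE -s0 -s1 -s2 !mem_imset_perm; congr (_ && _).
  suff -> : block_type (s @: B) = block_type B by [].
  apply/esym/eqP; rewrite -orbit_block.
  exact: (mem_orbit 'P^* B Gs).
transitivity (\sum_(A | block_type A == v) #|[set y in Y | E A y]|)%N.
  under eq_bigr => y _ do rewrite -sum1_card big_mkcond.
  rewrite exchange_big [RHS]big_mkcond; apply: eq_bigr => A _ /=.
  case: eqP => [tA | /eqP/negbTE ntA]; last first.
    by rewrite big1 // => y _; rewrite inE ntA.
  rewrite -sum1_card [RHS]big_mkcond [LHS]big_mkcond /=; apply: eq_bigr => y _.
  by rewrite !inE tA eqxx; case: (_ && _).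
rewrite mulnC -sum_nat_const; apply: eq_big => [A | A]; first by rewrite inE.
rewrite block_typeE => /and3P[/eqP v0 /eqP v1 /eqP v2].
have countE j : #|[set i in block_set j | (i \in A) == b]| =
                side_count #|block_set j| #|A :&: block_set j| b.
  rewrite /side_count; case: (b).
    by apply: eq_card => i; rewrite !inE eqb_id andbC.
  rewrite -(cardsID A (block_set j)) setIC addKn; apply: eq_card => i.
  by rewrite !inE eqbF_neg andbC.
have := (countE 0%N, countE 1%N, countE 2%N).
rewrite c0 c1 c2 v0 v1 v2 => -[[<- <-] <-].
rewrite -!cardsX; apply: eq_card => -[[y0 y1] y2].
by rewrite !inE /E /=; do !case: (_ == _).
Qed.

Hypotheses (n1_gt0 : (0 < n1)%N) (n2_gt0 : (0 < n2)%N) (n3_gt0 : (0 < n3)%N).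

Let x0 : 'I_N := first_I1 n2 n3 n1_gt0.
Let x1 : 'I_N := first_I2 n1 n3 n2_gt0.
Let x2 : 'I_N := first_I3 n1 n2 n3_gt0.
Let g : 'S_N := g3 n1_gt0 n2_gt0 n3_gt0.

Lemma block_first : [/\ block x0 = 0%N, block x1 = 1%N & block x2 = 2%N].
Proof.
rewrite /block /=; split; first by rewrite n1_gt0.
  by rewrite ltnn -[X in (X < _)%N]addn0 ltn_add2l n2_gt0.
by rewrite ltnn ltnNge leq_addr.
Qed.

(** Passing from A to its preimage changes the count in a block only at the moved
    point of that block, where membership is replaced by that of the next moved
    point. *)
Lemma block_type_g3 A :
  (block_type A == block_type ('P^*%act A g^-1%g)) =
  ((x0 \in A) == (x1 \in A)) && ((x1 \in A) == (x2 \in A)).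
Proof.
set B := 'P^*%act A g^-1%g.
have [b0 b1 b2] := block_first.
have [g0 g1 g2 gi] := g3_cycle n1_gt0 n2_gt0 n3_gt0.
have memB i : (i \in B) = (g i \in A).
  by rewrite -[i in LHS](permK g) /B setactPE mem_imset_perm.
have [c0 c1 c2] := card_block_sets.
have le j (E : {set 'I_N}) : (#|E :&: block_set j| <= #|block_set j|)%N.
  by rewrite subset_leq_card ?subsetIr.
have three i j : i \in [:: x0; x1; x2] -> j \in [:: x0; x1; x2] ->
    block i = block j -> i = j.
  by rewrite !inE => /or3P[]/eqP-> /or3P[]/eqP->; rewrite ?b0 ?b1 ?b2.
have cnt j x : block x = j -> x \in [:: x0; x1; x2] ->
    (#|B :&: block_set j| + (x \in A) = #|A :&: block_set j| + (x \in B))%N.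
  move=> bx x012; rewrite (cardsD1 x (B :&: _)) (cardsD1 x (A :&: _)) !in_setI.
  rewrite ![x \in block_set _]inE bx eqxx !andbT.
  suff -> : (B :&: block_set j) :\ x = (A :&: block_set j) :\ x.
    by rewrite addnC addnA addnAC.
  apply/setP => i; rewrite !inE memB.
  have [-> // | neq_ix] := eqVneq i x.
  have [bi | nbi] := eqVneq (block i) j; rewrite ?andbF ?andbT //=.
  rewrite gi //; apply: contra_neqN neq_ix => i012.
  by apply: three; rewrite ?bx.
have := cnt _ _ b0; have := cnt _ _ b1; have := cnt _ _ b2.
rewrite !inE !eqxx !orbT => /(_ isT) e2 /(_ isT) e1 /(_ isT) e0.
rewrite block_typeE /= !inordK ?ltnS -?c0 -?c1 -?c2 //.
move: e0 e1 e2; rewrite !memB [g x0]g0 [g x1]g1 [g x2]g2.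
by case: (x0 \in A); case: (x1 \in A); case: (x2 \in A) => /=; lia.
Qed.

(** n1 n2 n3 times the average of the permutation character on subsets of size l
    over the coset of the 3-cycle; c counts the points in the third block. *)
Definition young_sum (l : nat) : nat :=
  (\sum_(a < n1.+1) \sum_(b < n2.+1) \sum_(c < n3.+1 | a + b + c == l)
     (a * b * c + (n1 - a) * (n2 - b) * (n3 - c)))%N.

(** In [twisted_burnside] only the subsets that contain all three moved points or
    none of them contribute, by [block_type_g3]; grouping by type,
    [card_triples_in_orbit] gives their proportion within each orbit, and every
    type with a + b + c = l occurs. *)
Lemma young_average_subset_char (B : {set 'I_N}) :
  #|young_subgroup n1 n2 n3|%:R^-1 *
    \sum_(h in young_subgroup n1 n2 n3) subset_char B (h * g)%g =
  (n1%:R * n2%:R * n3%:R)^-1 * (young_sum #|B|)%:R.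
Proof.
rewrite young_subgroupE.
pose S := [set A : {set 'I_N} | #|A| == #|B|].
transitivity (#|colour_grp block|%:R^-1 * \sum_(h in colour_grp block)
    #|[set A in S | 'P^*%act A (h * g)%g == A]|%:R : algC).
  congr (_ * _); apply: eq_bigr => h _; rewrite subset_charE; congr _%:R.
  by apply: eq_card => A; rewrite !inE.
rewrite twisted_burnside.
have nz : (n1 * n2 * n3)%N%:R != 0 :> algC.
  by rewrite pnatr_eq0 -lt0n !muln_gt0 n1_gt0 n2_gt0.
have card_orbit A : #|orbit 'P^* (colour_grp block) A| =
                     #|[set A' | block_type A' == block_type A]|.
  by apply: eq_card => A'; rewrite orbit_block inE eq_sym.
rewrite (partition_big block_type predT) //= /young_sum.
have -> : (\sum_(a < n1.+1) \sum_(b < n2.+1) \sum_(c < n3.+1 | a + b + c == #|B|)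
     (a * b * c + (n1 - a) * (n2 - b) * (n3 - c)) =
   \sum_(v : V | v.1.1 + v.1.2 + v.2 == #|B|)
     (v.1.1 * v.1.2 * v.2 + (n1 - v.1.1) * (n2 - v.1.2) * (n3 - v.2)))%N.
  by rewrite pair_bigA /= pair_big_dep.
rewrite natr_sum mulr_sumr [RHS]big_mkcond; apply: eq_bigr => v _ /=.
case: eqP => [v_B | v_nB]; last first.
  rewrite big1 // => A; rewrite inE => /andP[/eqP cA /eqP tA].
  by case: v_nB; rewrite -tA -card_block_type.
have [b0 b1 b2] := block_first.
have trip b := card_triples_in_orbit v b b0 b1 b2.
pose O := [set A | block_type A == v].
pose E b A := [&& (x0 \in A) == b, (x1 \in A) == b & (x2 \in A) == b].
have nzO : #|O|%:R != 0 :> algC.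
  have [A tA] := block_type_surj v; rewrite pnatr_eq0 -lt0n.
  by apply/card_gt0P; exists A; rewrite inE tA.
have sumE b : \sum_(A in O) (E b A)%:R =
              #|[set A | block_type A == v & E b A]|%:R :> algC.
  rewrite -sum1_card natr_sum big_mkcond [RHS]big_mkcond; apply: eq_bigr => A _ /=.
  by rewrite !inE; case: (_ == v) => //=; case: (E b A).
transitivity (#|O|%:R^-1 * \sum_(A in O) ((E true A)%:R + (E false A)%:R) : algC).
  rewrite mulr_sumr; apply: eq_big => [A | A /andP[_ /eqP tA]].
    rewrite !inE andb_idl // => /eqP tA.
    by rewrite (card_block_type A) tA; apply/eqP.
  rewrite card_orbit tA orbit_block block_type_g3 mulrC -natrD; congr (_ * _%:R).
  by rewrite /E; case: (x0 \in A); case: (x1 \in A); case: (x2 \in A).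
rewrite big_split /= !sumE -natrD.
apply: (mulfI nz).
rewrite -!(natrM algC n1) -(natrM algC (n1 * n2)%N) [RHS]mulVKf //.
rewrite mulrCA -(natrM _ (n1 * n2 * n3)%N) mulnDr !trip -mulnDl mulnC natrM.
by rewrite mulKf.
Qed.

End YoungAverage.

(** * Sums over the diagonals of a rectangle *)

Section Diagonals.

Variables m M : nat.
Implicit Type f : nat -> nat -> algC.

Definition diag_sum f (s : nat) : algC :=
  \sum_(a < m.+1) \sum_(b < M.+1 | (a + b == s)%N) f a b.

(** Each (a, b) lies on exactly one diagonal, so the sum over a range of
    diagonals is a sum over the whole rectangle. *)
Lemma sum_diag_sum f (i j : nat) :
  \sum_(i <= s < j) diag_sum f s =
  \sum_(a < m.+1) \sum_(b < M.+1) (if (i <= a + b < j)%N then f a b else 0).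
Proof.
rewrite exchange_big; apply: eq_bigr => a _ /=.
under eq_bigr => s _ do rewrite big_mkcond.
rewrite exchange_big; apply: eq_bigr => b _ /=; rewrite -big_mkcond /=.
under eq_bigl => s do rewrite eq_sym.
exact: big_nat1_eq.
Qed.

Lemma diag_sum_cond f s :
  diag_sum f s = \sum_(a < m.+1 | (a <= s <= a + M)%N) f a (s - a)%N.
Proof.
rewrite [RHS]big_mkcond; apply: eq_bigr => a _ /=.
have [le_as | lt_sa] := leqP a s; last first.
  by rewrite /= big1 // => b /eqP; lia.
rewrite -(big_mkord (fun b => a + b == s)%N (f a)) /=.
rewrite (eq_bigl (fun b => b == (s - a)%N)) ?big_nat1_eq /= => [|b]; last by lia.
by rewrite ltnS leq_subLR.
Qed.

Lemma diag_sum_low f s :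
  (s <= m)%N -> (s <= M)%N -> diag_sum f s = \sum_(a < s.+1) f a (s - a)%N.
Proof.
move=> sm sM; rewrite diag_sum_cond.
rewrite (big_ord_widen_cond m.+1 predT (fun a => f a (s - a)%N)) //.
by apply: eq_bigl => a /=; lia.
Qed.

Lemma diag_sum_mid f s :
  (m <= s)%N -> (s <= M)%N -> diag_sum f s = \sum_(a < m.+1) f a (s - a)%N.
Proof.
move=> ms sM; rewrite diag_sum_cond; apply: eq_bigl => a.
by have := ltn_ord a; lia.
Qed.

(** The half-turn of the rectangle. *)
Lemma diag_sum_rev f s :
    (s <= m + M)%N ->
  diag_sum f (m + M - s) = diag_sum (fun a b => f (m - a)%N (M - b)%N) s.
Proof.
move=> le_s; rewrite /diag_sum (reindex_inj rev_ord_inj); apply: eq_bigr => a _ /=.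
rewrite (reindex_inj rev_ord_inj) /=.
apply: eq_big => [b | b _]; last by rewrite !subSS.
by have := ltn_ord a; have := ltn_ord b; lia.
Qed.

Definition p_sum := diag_sum (fun a b => a%:R * b%:R).
Definition q_sum := diag_sum (fun a b => (m - a)%N%:R * (M - b)%N%:R).

Lemma q_sum_rev s : (s <= m + M)%N -> q_sum s = p_sum (m + M - s).
Proof. by move=> le_s; rewrite [RHS]diag_sum_rev. Qed.

Lemma p_sum_rev s : (s <= m + M)%N -> p_sum s = q_sum (m + M - s).
Proof. by move=> le_s; rewrite q_sum_rev ?subKn // leq_subr. Qed.

(** The half-turn exchanges p and q, and the range from t+1 to k-1 is symmetric
    under s -> m + M - s. *)
Lemma sum_pq_antisym (t k : nat) :
  (t + k = m + M)%N -> \sum_(t.+1 <= s < k) (p_sum s - q_sum s) = 0.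
Proof.
move=> tk; have rev : \sum_(t.+1 <= s < k) (p_sum s - q_sum s) =
                      - \sum_(t.+1 <= s < k) (p_sum s - q_sum s).
  rewrite {1}big_nat_rev /= -sumrN !big_nat; apply: eq_bigr => s lt_s.
  rewrite opprB p_sum_rev ?[in X in _ - X]q_sum_rev; try lia.
  by congr (q_sum _ - p_sum _); lia.
by move/eqP: rev; rewrite -subr_eq0 opprK -mulr2n mulrn_eq0 /= => /eqP.
Qed.

Hypothesis le_mM : (m <= M)%N.

Lemma sum_quadratic (n : nat) (x y z : algC) :
  \sum_(a < n.+1) (x + y * a%:R + z * a%:R ^+ 2) =
  (n%:R + 1) * (x + y * n%:R / 2 + z * (n%:R * (2 * n%:R + 1)) / 6).
Proof.
elim: n => [|n IHn]; first by rewrite big_ord1 /=; field.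
by rewrite big_ord_recr IHn /= -(natr1 n); field.
Qed.

Lemma p_sum_low s : (s <= m)%N -> p_sum s = (s%:R - 1) * s%:R * (s%:R + 1) / 6.
Proof.
move=> sm; rewrite /p_sum diag_sum_low //; last exact: leq_trans le_mM.
rewrite (eq_bigr (fun a : 'I_s.+1 => 0 + s%:R * a%:R + (- 1) * a%:R ^+ 2)).
  by rewrite sum_quadratic; field.
by move=> a _; rewrite natrB -1?ltnS //; ring.
Qed.

Lemma q_sum_low s : (s <= m)%N ->
  q_sum s = (s%:R - 1) * s%:R * (s%:R + 1) / 6
            + (s%:R + 1) * (m%:R * M%:R - (m%:R + M%:R) * s%:R / 2).
Proof.
move=> sm; have sM := leq_trans sm le_mM.
rewrite /q_sum diag_sum_low //.
rewrite (eq_bigr (fun a : 'I_s.+1 => m%:R * (M%:R - s%:R)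
  + (m%:R - M%:R + s%:R) * a%:R + (- 1) * a%:R ^+ 2)).
  by rewrite sum_quadratic; field.
move=> a _; have := ltn_ord a; rewrite ltnS => le_a.
by rewrite natrB ?natrB ?natrB //; [ring | lia..].
Qed.

Lemma p_sum_mid s : (m <= s <= M)%N ->
  p_sum s = s%:R * m%:R * (m%:R + 1) / 2 - m%:R * (m%:R + 1) * (2 * m%:R + 1) / 6.
Proof.
case/andP=> ms sM; rewrite /p_sum diag_sum_mid //.
rewrite (eq_bigr (fun a : 'I_m.+1 => 0 + s%:R * a%:R + (- 1) * a%:R ^+ 2)).
  by rewrite sum_quadratic; field.
by move=> a _; rewrite natrB; [ring | have := ltn_ord a; lia].
Qed.

Lemma q_sum_mid s : (m <= s <= M)%N ->
  q_sum s = s%:R * m%:R * (m%:R + 1) / 2 - m%:R * (m%:R + 1) * (2 * m%:R + 1) / 6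
            + (m%:R + 1) * m%:R * ((m%:R + M%:R) / 2 - s%:R).
Proof.
case/andP=> ms sM; rewrite /q_sum diag_sum_mid //.
rewrite (eq_bigr (fun a : 'I_m.+1 => m%:R * (M%:R - s%:R)
  + (m%:R - M%:R + s%:R) * a%:R + (- 1) * a%:R ^+ 2)).
  by rewrite sum_quadratic; field.
move=> a _; have := ltn_ord a; rewrite ltnS => le_a.
by rewrite natrB ?natrB ?natrB //; [ring | lia..].
Qed.

(** A discrete primitive of q - p on the diagonals s <= m. *)
Definition low_primitive (x y t : algC) :=
  x * y * t * (t + 1) / 2 - (x + y) * (t - 1) * t * (t + 1) / 6.

Lemma sum_pq_low (i t : nat) : (i <= t)%N -> (t <= m.+1)%N ->
  \sum_(i <= s < t) (p_sum s - q_sum s) =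
  low_primitive m%:R M%:R i%:R - low_primitive m%:R M%:R t%:R.
Proof.
move=> it tm.
pose S s := low_primitive m%:R M%:R s%:R.
rewrite -[LHS]opprK -sumrN (eq_big_nat _ _ (F2 := fun s => S s.+1 - S s)).
  by rewrite telescope_sumr // opprB.
move=> s /andP[_ st]; have sm : (s <= m)%N by lia.
by rewrite p_sum_low // q_sum_low // /S /low_primitive -(natr1 s); field.
Qed.

(** A discrete primitive of q - p on the diagonals m <= s <= M. *)
Definition mid_primitive (x y t : algC) :=
  (x + 1) * x * ((x + y) * t / 2 - (t - 1) * t / 2).

Lemma sum_pq_mid (i t : nat) : (m <= i <= t)%N -> (t <= M.+1)%N ->
  \sum_(i <= s < t) (p_sum s - q_sum s) =
  mid_primitive m%:R M%:R i%:R - mid_primitive m%:R M%:R t%:R.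
Proof.
case/andP=> mi it tM.
pose S s := mid_primitive m%:R M%:R s%:R.
rewrite -[LHS]opprK -sumrN (eq_big_nat _ _ (F2 := fun s => S s.+1 - S s)).
  by rewrite telescope_sumr // opprB.
move=> s /andP[ls st]; have sm : (m <= s <= M)%N by lia.
by rewrite p_sum_mid // q_sum_mid // /S /mid_primitive -(natr1 s); field.
Qed.

End Diagonals.

(** * The closed formula *)

Lemma young_sum_diag m M n3 l :
  (young_sum m M n3 l)%:R =
  \sum_(a < m.+1) \sum_(b < M.+1)
    (if (a + b <= l <= a + b + n3)%N
     then (a * b * (l - (a + b)) + (m - a) * (M - b) * (n3 - (l - (a + b))))%N%:R
     else 0) :> algC.
Proof.
rewrite natr_sum; apply: eq_bigr => a _; rewrite natr_sum; apply: eq_bigr => b _.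
have [le_l | lt_l] := leqP (a + b) l; last by rewrite big1 // => c /eqP; lia.
rewrite -(big_mkord (fun c => a + b + c == l)%N
  (fun c => a * b * c + (m - a) * (M - b) * (n3 - c))%N).
rewrite (eq_bigl (fun c => c == (l - (a + b))%N)) => [|c]; last by lia.
rewrite big_nat1_eq /=.
by rewrite ltnS leq_subLR; case: ifP.
Qed.

(** A pair (a, b) on the diagonal s meets size l when l = s + c with
    0 <= c <= n3.  If it meets both k and k-1, then c drops by one and the
    difference is a b - (m - a)(M - b).  The diagonal s = k meets k only, with
    c = 0, and s = k-1-n3 meets k-1 only, with c = n3; the last sum has this one
    term if n3 < k, and is empty otherwise because both truncated bounds are 0. *)
Lemma young_sum_diff m M n3 k :
    (0 < k)%N -> (0 < n3)%N ->
  (young_sum m M n3 k)%:R - (young_sum m M n3 k.-1)%:R =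
  \sum_((k - n3)%N <= s < k) (p_sum m M s - q_sum m M s)
  + n3%:R * q_sum m M k
  - n3%:R * \sum_((k.-1 - n3)%N <= s < (k - n3)%N) p_sum m M s :> algC.
Proof.
move=> k_gt0 n3_gt0; rewrite !young_sum_diag.
have -> : q_sum m M k = \sum_(k <= s < k.+1) q_sum m M s by rewrite big_nat1.
rewrite sumrB !sum_diag_sum !mulr_sumr -!sumrB -big_split -sumrB.
apply: eq_bigr => a _ /=; rewrite !mulr_sumr -!sumrB -big_split -sumrB.
apply: eq_bigr => b _ /=.
have := ltn_ord a; have := ltn_ord b; move: (nat_of_ord a) (nat_of_ord b).
move=> {}a {}b; rewrite !ltnS => le_b le_a; set s := (a + b)%N.
rewrite -!natrM; set q := ((m - a) * (M - b))%N; set p := (a * b)%N.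
have [lt_ks | le_sk] := orP (orbN (k < s)%N).
  by do ![rewrite ifF; last by lia]; ring.
have [eq_sk | neq_sk] := eqVneq s k.
  rewrite eq_sk in le_sk *; rewrite subnn muln0 add0n subn0.
  rewrite [X in X - _]ifT; last by lia.
  rewrite [X in _ + n3%:R * X]ifT; last by lia.
  by do ![rewrite ifF; last by lia]; rewrite natrM; ring.
have [lt_n3 | le_n3] := orP (orbN (s + n3 < k)%N).
  have [lt_n3' | le_n3'] := orP (orbN (s + n3 < k.-1)%N).
    by do ![rewrite ifF; last by lia]; ring.
  rewrite [X in _ - X = _]ifT; last by lia.
  rewrite [X in _ - n3%:R * X]ifT; last by lia.
  do ![rewrite ifF; last by lia].
  have -> : (k.-1 - s)%N = n3 by lia.
  by rewrite subnn muln0 addn0 natrM; ring.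
have [d dE] : exists d, (k = s + d.+1)%N by exists (k - s).-1; lia.
do 2![rewrite ifT; last by lia].
rewrite [X in X - _ + _]ifT; last by lia.
rewrite [X in _ - X + _]ifT; last by lia.
do ![rewrite ifF; last by lia].
have -> : (k - s)%N = d.+1 by lia.
have -> : (k.-1 - s)%N = d by lia.
have -> : (n3 - d)%N = (n3 - d.+1).+1 by lia.
by rewrite !natrD !natrM -(natr1 d) -(natr1 (n3 - _)); ring.
Qed.

(** The factor multiplying mu + 1 in the closed formula, without its xi term. *)
Definition main_bracket {F : fieldType} (N x y z mu nu delta : F) : F :=
  6^-1 * N * mu * (mu - 1)
  + 2^-1 * N * (mu * nu + mu * delta + 2 * nu * delta)
  - 2^-1 * (mu + 2 * nu) * (x * y + x * z + y * z)
  + x * y * z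
  + 2^-1 * mu * nu * (nu - 1)
  + (nu - delta) * (x * y + nu * delta)
  - 2^-1 * mu * delta * (delta - 1).

(** Induction on the number of terms.  The product hypothesis says that nu is 0
    or K - z, the two possible values of m_L, and the identity is polynomial in
    either case. *)
Lemma sum_zeta (x y z K nu : algC) (n u : nat) :
    nu = n%:R -> nu * (z - K + nu) = 0 ->
  \sum_(n <= m < (n + u).+1) zeta x y z K m%:R =
  (u%:R + 1) * main_bracket (x + y + z) x y z u%:R nu (K - nu - u%:R).
Proof.
move=> nuE rel.
have z_nu : nu = 0 \/ z = K - nu.
  move/eqP: rel; rewrite mulf_eq0 => /orP[/eqP | /eqP rel]; first by left.
  by right; rewrite -[LHS]subr0 -rel; ring.
elim: u => [|u IHu].
  rewrite addn0 big_nat1 /zeta /main_bracket -nuE.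
  by case: z_nu => ->; field.
rewrite addnS big_nat_recr /=; last by lia.
rewrite IHu -(natr1 u) -addnS natrD -nuE -natr1 /zeta /main_bracket.
by case: z_nu => ->; field.
Qed.

Definition closed_form (n1 n2 n3 k nu u : nat) : algC :=
  (u%:R - nu%:R + 1)
  * main_bracket (n1 + n2 + n3)%:R n1%:R n2%:R n3%:R
                 (u%:R - nu%:R) nu%:R (k%:R - u%:R)
  - xi n1%:R n2%:R n3%:R k%:R u%:R.

(** The minimum m_U is k, m or m + M - k according to whether k <= m,
    m < k <= M or M < k.  In the second case the sum over diagonals is cut at m;
    in the last one only the diagonals up to m + M - k survive, the others
    cancelling by antisymmetry. *)
Lemma young_sum_diff_le m M n3 k :
    (0 < k)%N -> (0 < n3)%N -> (m <= M)%N -> (k <= m + M)%N ->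
    (k - n3 <= minn m (minn M (minn k (m + M - k))))%N ->
  (young_sum m M n3 k)%:R - (young_sum m M n3 k.-1)%:R =
  closed_form m M n3 k (k - n3) (minn m (minn M (minn k (m + M - k)))).
Proof.
move=> k_gt0 n3_gt0 le_mM le_k; set nu := (k - n3)%N => le_nu.
have nu_m : (nu <= m)%N by lia.
have nu_k : (nu <= k)%N by lia.
rewrite young_sum_diff // -/nu.
have -> : \sum_((k.-1 - n3)%N <= s < nu) p_sum m M s =
          (nu%:R - 2) * (nu%:R - 1) * nu%:R / 6.
  have [nu0 | nu_gt0] := posnP nu.
    by rewrite nu0 big_geq ?mulr0 ?mul0r //; lia.
  have -> : (k.-1 - n3)%N = nu.-1 by lia.
  have nuE : nu%:R = nu.-1%:R + 1 :> algC by rewrite natr1 prednK.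
  rewrite -[X in \sum_(_ <= s < X) _](prednK nu_gt0) big_nat1.
  rewrite p_sum_low //; last by lia.
  by rewrite nuE; field.
have z_nu : (nu%:R = 0 :> algC) \/ (n3%:R = k%:R - nu%:R :> algC).
  have [le | lt] := leqP k n3; [left | right].
    by rewrite (_ : nu = 0%N) //; lia.
  by rewrite -natrB //; congr _%:R; lia.
rewrite /closed_form /xi /main_bracket eqr_nat !natrD.
have [le_km | lt_mk] := leqP k m.
  have -> : minn m (minn M (minn k (m + M - k))) = k by lia.
  rewrite eqxx sum_pq_low //; last by lia.
  rewrite q_sum_low // /low_primitive.
  by case: z_nu => ->; field.
have [le_kM | lt_Mk] := leqP k M.
  have -> : minn m (minn M (minn k (m + M - k))) = m by lia.
  rewrite (ltn_eqF lt_mk) (big_cat_nat (n := m)) //=; last by lia.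
  rewrite sum_pq_low ?sum_pq_mid ?q_sum_mid ?leqnn /=; try lia.
  rewrite /low_primitive /mid_primitive.
  have nz : M%:R - m%:R != 0 :> algC.
    by rewrite subr_eq0 eqr_nat; lia.
  have nz' : m%:R + M%:R - 2 * m%:R != 0 :> algC.
    by rewrite (_ : _ - _ = M%:R - m%:R) //; ring.
  by case: z_nu => ->; field.
(* t < m <= M < k, and k lies opposite to t under the half-turn *)
have [t tE] : exists t, (m + M - k)%N = t by exists (m + M - k)%N.
have -> : minn m (minn M (minn k (m + M - k))) = t by lia.
rewrite ltn_eqF; last by lia.
rewrite (big_cat_nat (n := t.+1)) /=; try lia.
rewrite (sum_pq_antisym (t := t)) ?addr0; try lia.
rewrite sum_pq_low //; try lia.
rewrite q_sum_rev // tE p_sum_low; try lia.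
have kE : k%:R = m%:R + M%:R - t%:R :> algC.
  by rewrite -natrD -natrB; [congr _%:R; lia | lia].
rewrite /low_primitive -(natr1 t).
have nz : m%:R + M%:R - 2 * t%:R != 0 :> algC.
  by rewrite -natrD -natrM subr_eq0 eqr_nat; lia.
by case: z_nu => ->; rewrite kE; field.
Qed.

Lemma young_sumC n1 n2 n3 l : young_sum n1 n2 n3 l = young_sum n2 n1 n3 l.
Proof.
rewrite /young_sum exchange_big; apply: eq_bigr => b _; apply: eq_bigr => a _.
apply: eq_big => [c | c _]; first by rewrite (addnC a).
by rewrite (mulnC a) (mulnC (n1 - a)%N).
Qed.

Lemma closed_formC n1 n2 n3 k nu u :
  closed_form n1 n2 n3 k nu u = closed_form n2 n1 n3 k nu u.
Proof.
rewrite /closed_form /main_bracket /xi (addnC n1) (addrC n1%:R) (mulrC n1%:R).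
by case: ifP => _; ring.
Qed.

Lemma young_sum_diff_closed n1 n2 n3 k :
    (0 < k)%N -> (0 < n3)%N -> (k <= n1 + n2)%N ->
    (k - n3 <= minn n1 (minn n2 (minn k (n1 + n2 - k))))%N ->
  (young_sum n1 n2 n3 k)%:R - (young_sum n1 n2 n3 k.-1)%:R =
  closed_form n1 n2 n3 k (k - n3) (minn n1 (minn n2 (minn k (n1 + n2 - k)))).
Proof.
move=> k_gt0 n3_gt0 le_k.
have [le12 | /ltnW le21] := leqP n1 n2; first exact: young_sum_diff_le.
 rewrite minnCA !(young_sumC n1) closed_formC (addnC n1 n2) => le_nu.
by apply: young_sum_diff_le => //; rewrite addnC in le_k.
Qed.

Lemma spherical_two_rows n1 n2 n3 k
    (n1_gt0 : (0 < n1)%N) (n2_gt0 : (0 < n2)%N) (n3_gt0 : (0 < n3)%N) :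
    (0 < k)%N -> (2 * k <= n1 + n2 + n3)%N ->
  spherical [:: (n1 + n2 + n3 - k)%N; k] (g3 n1_gt0 n2_gt0 n3_gt0) =
  (n1%:R * n2%:R * n3%:R)^-1 *
    ((young_sum n1 n2 n3 k)%:R - (young_sum n1 n2 n3 k.-1)%:R).
Proof.
move=> k_gt0 le_2k; set N := (n1 + n2 + n3)%N in le_2k *.
have [|B _ cardB] := @subset_of_card _ [set: 'I_N] k.-1.
  by rewrite cardsT card_ord; lia.
rewrite /spherical (irr_char_two_rows k_gt0 le_2k cardB).
under eq_bigr => h _ do rewrite !cfunE.
rewrite sumrB mulrBr !young_average_subset_char cardB card_second_row //.
by rewrite -mulrBr.
Qed.

(** m_L >= 0 forces k <= n_1 + n_2, so that both bounds are natural numbers. *)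
Lemma mU_nat n1 n2 n3 k : mL n3 k <= mU n1 n2 k ->
  [/\ (k <= n1 + n2)%N, mL n3 k = (k - n3)%N :> int
    & mU n1 n2 k = minn n1 (minn n2 (minn k (n1 + n2 - k))) :> int].
Proof. by rewrite /mL /mU => le_LU; split; lia. Qed.

Theorem mainTheorem2 (n1 n2 n3 k : nat)
    (n1_gt0 : (0 < n1)%N) (n2_gt0 : (0 < n2)%N) (n3_gt0 : (0 < n3)%N)
    (k_gt0 : (1 <= k)%N) (k_le : (2 * k <= n1 + n2 + n3)%N)
    (mL_le_mU : mL n3 k <= mU n1 n2 k) :
  let Phi : algC :=
    spherical [:: (n1 + n2 + n3 - k)%N; k] (g3 n1_gt0 n2_gt0 n3_gt0) in
  let N : algC := (n1 + n2 + n3)%:R in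
  let a1 : algC := n1%:R in
  let a2 : algC := n2%:R in
  let a3 : algC := n3%:R in
  let K : algC := k%:R in
  let mu : algC := (mU n1 n2 k - mL n3 k)%:~R in
  let nu : algC := (mL n3 k)%:~R in
  let delta : algC := (k%:Z - mU n1 n2 k)%:~R in
  [/\ Phi =
        (a1 * a2 * a3)^-1
        * (\sum_(0 <= m < k.+1 | mL n3 k <= m%:Z <= mU n1 n2 k)
             zeta a1 a2 a3 K m%:R
           - xi a1 a2 a3 K (mU n1 n2 k)%:~R),
      Phi =
        (mu + 1) / (a1 * a2 * a3)
        * (6^-1 * N * mu * (mu - 1)
           + 2^-1 * N * (mu * nu + mu * delta + 2 * nu * delta)
           - 2^-1 * (mu + 2 * nu) * (a1 * a2 + a1 * a3 + a2 * a3)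
           + a1 * a2 * a3
           + 2^-1 * mu * nu * (nu - 1)
           + (nu - delta) * (a1 * a2 + nu * delta)
           - 2^-1 * mu * delta * (delta - 1)
           - (mu + 1)^-1 * xi a1 a2 a3 K (mU n1 n2 k)%:~R)
    & (k <= n3)%N ->
      Phi =
        (mu + 1) / (a1 * a2 * a3)
        * (a1 * a2 * a3
           - 2^-1 * mu * (a1 * a2 + a1 * a3 + a2 * a3)
           + 6^-1 * N * mu * (mu - 1)
           + 2^-1 * (K - mu) * (mu * (N - K + mu + 1) - 2 * a1 * a2)
           - (mu + 1)^-1 * xi a1 a2 a3 K mu)].
Proof.
have [le_k defL defU] := mU_nat mL_le_mU.
move: mL_le_mU; rewrite defL defU lez_nat => le_nu.
have Phi_closed := spherical_two_rows n1_gt0 n2_gt0 n3_gt0 k_gt0 k_le.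
rewrite (young_sum_diff_closed k_gt0 n3_gt0 le_k le_nu) in Phi_closed.
move: le_nu Phi_closed; set nu_ := (k - n3)%N; set u := minn n1 _ => le_nu Phi_closed.
have u_k : (u <= k)%N by rewrite /u; lia.
have mu_ge0 : 0 <= u%:R - nu_%:R :> algC by rewrite subr_ge0 ler_nat.
have mu1_neq0 : u%:R - nu_%:R + 1 != 0 :> algC.
  by rewrite gt_eqF // ltr_wpDl.
move=> Phi N a1 a2 a3 K mu nu delta.
have muE : mu = u%:R - nu_%:R by rewrite /mu intrB.
have nuE : nu = nu_%:R by [].
have deltaE : delta = K - u%:R by rewrite /delta intrB.
have NE : N = a1 + a2 + a3 by rewrite /N !natrD.
have a1_neq0 : a1 != 0 by rewrite pnatr_eq0 -lt0n.
have a2_neq0 : a2 != 0 by rewrite pnatr_eq0 -lt0n.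
have a3_neq0 : a3 != 0 by rewrite pnatr_eq0 -lt0n.
have form2 : Phi =
   (mu + 1) / (a1 * a2 * a3) *
   (main_bracket N a1 a2 a3 mu nu delta - (mu + 1)^-1 * xi a1 a2 a3 K u%:R).
  rewrite /Phi Phi_closed /closed_form -/a1 -/a2 -/a3 -/N -/K -muE -nuE -deltaE.
  move: (main_bracket _ _ _ _ _ _ _) (xi _ _ _ _ _) => br x; field.
  by apply/and4P; split.
split=> [|| le_k3].
- rewrite /Phi Phi_closed /closed_form; congr (_ * (_ - _)).
  rewrite -(natrB _ le_nu) -/N NE -/K.
  rewrite (_ : K - u%:R = K - nu_%:R - (u - nu_)%N%:R); last first.
    by rewrite (natrB _ le_nu); ring.
  rewrite -(sum_zeta a1 a2 (n := nu_)) //; last first.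
    have [nu0 | nu_gt0] := posnP nu_; first by rewrite nu0 mul0r.
    by rewrite /nu_ natrB; [rewrite -/a3 -/K; ring | lia].
  by rewrite subnKC // (big_nat_widenl _ 0%N) // (big_nat_widen _ _ k.+1).
- exact: form2.
have nu0 : nu_ = 0%N by apply/eqP.
have mu_u : mu = u%:R by rewrite muE nu0 subr0.
rewrite form2 -mu_u /main_bracket deltaE nuE nu0 -mu_u NE.
by congr (_ * (_ - _)); field.
Qed.
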